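(* Let $F$ be a divisibly closed supertropical semifield. Let $f\in F\lfloor\lambda\rfloor$ be a monic semitangibly-full polynomial of degree $t\ge2$, and let $\alpha_1,\dots,\alpha_t$ be $t$ tangible corner roots of $f$ with distinct $\nu$-values, arranged in ascending $\nu$-value. Then, up to $(\nu,e)$-equivalence (which is $e$-equivalence if $\nu$ is injective on tangible elements), $$f=(\lambda^2+\alpha_t^\nu\lambda+\alpha_t\alpha_1)\prod_{k=2}^{t-1}(\lambda+\alpha_k).$$
   Context: All semirings are commutative (in both operations), with zero $0_R$ and unit $1_R$. A supertropical semiring is a triple $(R,\mathcal G_0,\nu)$ where $R$ is a semiring, $\mathcal G_0=\mathcal G\cup\{0_R\}$ is a semiring ideal of $R$ (the ghost ideal; its elements are ghosts), and $\nu:R\to\mathcal G_0$ (written $a^\nu=\nu(a)$, the $\nu$-value of $a$) is a semiring homomorphism with $\nu^2=\nu$ (where $\mathcal G_0$ is a semiring with unit $\nu(1_R)$), such that: $a+a=a^\nu$ for all $a$; $a+b\in\{a,b\}$ whenever $a^\nu\ne b^\nu$; and $a+b=a^\nu$ whenever $a^\nu=b^\nu$. $\mathcal G_0$ is totally ordered by $g\ge h\iff g+h=g$; write $a>_\nu b$ for $a^\nu>b^\nu$. It is a supertropical domain if the set $\mathcal T=R\setminus\mathcal G_0$ of tangible elements is a multiplicative monoid and $\nu|_{\mathcal T}:\mathcal T\to\mathcal G$ is onto; it is a supertropical semifield if moreover $\mathcal T$ is an Abelian group. The divisible closure $\bar R$ of a supertropical domain $R$ consists of formal roots $\sqrt[m]{a}$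 ($a\in R$, $m\ge1$), with $\sqrt[m]{a}=\sqrt[m']{b}$ when $a^{m'n}=b^{mn}$ for some $n\ge 1$, product $\sqrt[m]{a}\sqrt[m']{b}=\sqrt[mm']{a^{m'}b^m}$, sum $\sqrt[m]{a}+\sqrt[m']{b}=\sqrt[mm']{a^{m'}+b^m}$, and $\nu(\sqrt[m]{a})=\sqrt[m]{a^\nu}$. $R$ is divisibly closed if $\bar R=R$ (identifying $a$ with $\sqrt[1]{a}$). $F\lfloor\lambda\rfloor$ is the semiring of formal polynomials. Polynomials are $e$-equivalent if they define the same function $F\to F$; they are $(\nu,e)$-equivalent if at every point their values have the same $\nu$-value and the same parity (both tangible or both ghost). A monomial $h$ of $f$ is essential if $h(a)>_\nu f_h(a)$ for some $a\in F$, where $f_h$ is the sum of the other monomials; $f^{\mathrm{es}}$ is the sum of the essential monomials. For $f^{\mathrm{es}}=\sum_i\beta_i\lambda^i$, an element $a$ is a corner root of $f$ if the maximal value among the $(\beta_ia^i)^\nu$ is attained by at least two indices $i$. For $f=\sum_i\beta_i\lambda^i$, writing $\mathcal G$ additively, let $C_f$ be the convex hull (with rational weights) of the points $(i,\beta_i^\nu)$ with $\beta_i\ne0_F$, and $\bar C_f$ its upper boundary. A monomial $\beta_i\lambda^i$ is quasi-essential if $(i,\beta_i^\nu)$ lies on $\bar C_f$ but is not a vertex. $f$ is full if every point of $\bar C_f$ with integral first coordinate corresponds to a monomial of $f$ that is essential or quasi-essential, and the coefficient of every quasi-essential monomial is a ghost. A polynomial $\sum_{i=0}^t\beta_i\lambda^i$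 is semitangibly-full if it is full, $\beta_t$ and $\beta_0$ are tangible, and $\beta_i$ is a ghost for all $0<i<t$. Monic means leading coefficient $1_F$. *)

(* Defs.v *)
From HB Require Import structures.
From mathcomp Require Import all_boot all_order all_algebra.
From mathcomp Require Import boolp.

Set Implicit Arguments.
Unset Strict Implicit.
Unset Printing Implicit Defensive.

Import Order.TTheory GRing.Theory Num.Theory.
Local Open Scope ring_scope.

(* [ghost] is the ideal G_0, which contains 0; G is [ghost] without 0.
   [nu1_ghost] says that G_0 is a semiring with unit [nu 1].  A nonzero
   semiring is taken as base in order to form {poly R}; supertropical domains
   satisfy 1 <> 0 anyway, since 0 is a ghost and 1 is tangible. *)
HB.mixin Record isSupertropical R of GRing.ComNzSemiRing R := {
  ghost : {pred R};
  nu : R -> R;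
  ghost0 : 0 \in ghost;
  ghostD : forall g h, g \in ghost -> h \in ghost -> g + h \in ghost;
  ghostMl : forall a g, g \in ghost -> a * g \in ghost;
  nu_ghost : forall a, nu a \in ghost;
  nu0 : nu 0 = 0;
  nuD : forall a b, nu (a + b) = nu a + nu b;
  nuM : forall a b, nu (a * b) = nu a * nu b;
  nu1_ghost : forall g, g \in ghost -> nu 1 * g = g;
  nu_idem : forall a, nu (nu a) = nu a;
  addrr_nu : forall a, a + a = nu a;
  addr_bipotent : forall a b, nu a <> nu b -> a + b = a \/ a + b = b;
  addr_nu_eq : forall a b, nu a = nu b -> a + b = nu a
}.

#[short(type="supertropicalType")]
HB.structure Definition Supertropical :=
  {R of isSupertropical R & GRing.ComNzSemiRing R}.

Definition tangible (R : supertropicalType) : {pred R} :=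
  [pred a : R | a \notin ghost].
Arguments tangible {R}.

HB.mixin Record isSupertropicalDomain R of Supertropical R := {
  tangible1 : (1 : R) \in tangible;
  tangibleM : forall a b : R,
    a \in tangible -> b \in tangible -> a * b \in tangible;
  nu_tangible_neq0 : forall a : R, a \in tangible -> nu a != 0;
  nu_tangible_onto : forall g : R, g \in ghost -> g != 0 ->
    exists2 a : R, a \in tangible & nu a = g
}.

#[short(type="supertropicalDomainType")]
HB.structure Definition SupertropicalDomain :=
  {R of isSupertropicalDomain R & Supertropical R}.

HB.mixin Record isSupertropicalSemifield R of SupertropicalDomain R := {
  tangible_inv : forall a : R, a \in tangible ->
    exists2 b : R, b \in tangible & a * b = 1
}.

#[short(type="supertropicalSemifieldType")]
HB.structure Definition SupertropicalSemifield :=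
  {R of isSupertropicalSemifield R & SupertropicalDomain R}.

(* The order of G_0; only meaningful on ghosts. *)
Definition ghost_ge (R : supertropicalType) (g h : R) : bool := g + h == g.

Definition nu_gt (R : supertropicalType) (a b : R) : bool :=
  ghost_ge (nu a) (nu b) && (nu a != nu b).

(* Equality of the formal roots m-th root of a and m'-th root of b in the
   divisible closure (for m, m' >= 1). *)
Definition root_eq (R : supertropicalType) (m : nat) (a : R) (m' : nat) (b : R)
  : Prop :=
  exists2 n : nat, (0 < n)%N & a ^+ (m' * n) = b ^+ (m * n).

(* Every element of the divisible closure is the first root of an element of R.
   The operations of the closure restrict to those of R along b |-> root_1(b),
   so they need not be mentioned. *)
Definition divisibly_closed (R : supertropicalDomainType) : Prop :=
  forall (m : nat) (a : R), (0 < m)%N -> exists b : R, root_eq m a 1 b.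

Section Polynomials.
Variable R : supertropicalType.
Implicit Types f g : {poly R}.

Definition e_equiv f g : Prop := forall a : R, f.[a] = g.[a].

Definition nu_e_equiv f g : Prop :=
  forall a : R, nu f.[a] = nu g.[a] /\ (f.[a] \in ghost) = (g.[a] \in ghost).

Definition other_monomials f (i : nat) : {poly R} :=
  \poly_(j < size f) (if j == i then 0 else f`_j).

(* The monomial of index i is essential; nu_gt forces its coefficient to be
   nonzero. *)
Definition essential f (i : nat) : Prop :=
  exists a : R, nu_gt (f`_i * a ^+ i) (other_monomials f i).[a].

Definition essential_part f : {poly R} :=
  \poly_(i < size f) (if `[< essential f i >] then f`_i else 0).

Definition corner_root f (a : R) : Prop :=
  let fes := essential_part f in
  exists i j : nat,
    [/\ i <> j, fes`_i <> 0, fes`_j <> 0,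
        nu (fes`_i * a ^+ i) = nu (fes`_j * a ^+ j)
      & forall k : nat, ghost_ge (nu (fes`_i * a ^+ i)) (nu (fes`_k * a ^+ k))].

(* Points of the plane Q x G are pairs in rat * R with second component in G.
   Since G is written multiplicatively in R, the multiple q.g of g in G by a
   rational q >= 0 is an element r of G with r ^ denq q = g ^ numq q.  The nu
   on the right makes the zeroth power equal to the unit nu 1 of G. *)
Definition ghost_ratpow (g : R) (q : rat) (r : R) : Prop :=
  [/\ r \in ghost, r != 0 & r ^+ `|denq q|%N = nu (g ^+ `|numq q|%N)].

Definition convex_comb n (w : 'I_n -> rat) (p : 'I_n -> rat * R)
    (q : rat * R) : Prop :=
  [/\ forall i, 0 <= w i,
      \sum_i w i = 1,
      q.1 = \sum_i w i * (p i).1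
    & exists c : 'I_n -> R,
        (forall i, ghost_ratpow (p i).2 (w i) (c i)) /\ q.2 = \prod_i c i].

Definition convex_hull (S : rat * R -> Prop) (q : rat * R) : Prop :=
  exists n (w : 'I_n -> rat) (p : 'I_n -> rat * R),
    (forall i, S (p i)) /\ convex_comb w p q.

(* q lies in C and in no open segment between distinct points of C. *)
Definition vertex (C : rat * R -> Prop) (q : rat * R) : Prop :=
  C q /\
  forall (w : 'I_2 -> rat) (p : 'I_2 -> rat * R),
    (forall i, C (p i)) -> (forall i, 0 < w i) -> convex_comb w p q ->
    p ord0 = p ord_max.

Definition monomial_point f (i : nat) : rat * R := (i%:R, nu f`_i).

Definition poly_hull f : rat * R -> Prop :=
  convex_hull (fun q => exists2 i : nat, f`_i <> 0 & q = monomial_point f i).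

Definition upper_boundary f (q : rat * R) : Prop :=
  poly_hull f q /\ forall g : R, poly_hull f (q.1, g) -> ghost_ge q.2 g.

Definition quasi_essential f (i : nat) : Prop :=
  [/\ f`_i <> 0, upper_boundary f (monomial_point f i)
    & ~ vertex (poly_hull f) (monomial_point f i)].

Definition full f : Prop :=
  (forall q : rat * R, upper_boundary f q -> q.1 \is a Num.int ->
     exists i : nat,
       [/\ f`_i <> 0, q = monomial_point f i
         & essential f i \/ quasi_essential f i]) /\
  (forall i : nat, quasi_essential f i -> f`_i \in ghost).

Definition semitangibly_full f : Prop :=
  [/\ full f, lead_coef f \in tangible, f`_0 \in tangible
    & forall i : nat, (0 < i < (size f).-1)%N -> f`_i \in ghost].

End Polynomials.

(* Main.v *)
Require Import Defs.
From mathcomp Require Import all_boot all_order all_algebra.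
From mathcomp Require Import ring zify.

Set Implicit Arguments.
Unset Strict Implicit.
Unset Printing Implicit Defensive.

Import GRing.Theory.
Local Open Scope ring_scope.

(** Work with the order of nu-values.  The polynomial f has at most t + 1
    essential monomials, and as the argument grows the index of the dominant
    monomial can only grow; at each corner root two indices are dominant, so
    each corner root pushes the index up by at least one.  Having t corner
    roots with distinct nu-values therefore leaves no freedom: all monomials
    are essential and those of index k - 1 and k tie at alpha_k
    ([corner_root_tie]).  This says that beta_(k-1) and beta_k * alpha_k have
    the same nu-value, which determines the nu-values of all coefficients, and
    the max-plus fundamental theorem of algebra ([nu_sum_prod]) shows that f(a)
    has the nu-value of the product of all a + alpha_k.  So does the right-hand
    side, because alpha_t + alpha_1 has the nu-value of alpha_t, so that its
    quadratic factor has the nu-value of (a + alpha_t) (a + alpha_1).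

    For the parity, three positions of a are compared.  Above alpha_t both
    sides are equal to a ^ t.  Below alpha_1 both constant terms dominate, and
    they are tangible.  In between, beta_0 is at most beta_1 * a and a ^ t is at
    most beta_(t-1) * a ^ (t-1), so the ghost inner monomials absorb the two
    tangible ones; likewise alpha_t^nu * a absorbs the other two terms of the
    quadratic factor.  Hence both sides are ghosts. *)

(** * The order of nu-values *)

Section NuOrder.
Variable R : supertropicalType.
Implicit Types a b c d g : R.

Definition nu_le a b : bool := ghost_ge (nu b) (nu a).

Lemma nu_leP a b : reflect (nu a + nu b = nu b) (nu_le a b).
Proof. by rewrite /nu_le /ghost_ge addrC; apply: eqP. Qed.

Lemma nu_le_refl a : nu_le a a.
Proof. by apply/nu_leP; rewrite addrr_nu nu_idem. Qed.

Lemma nu_eq_le a b : nu a = nu b -> nu_le a b.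
Proof. by move=> e; rewrite /nu_le e; apply: nu_le_refl. Qed.

Lemma nu_le_trans b a c : nu_le a b -> nu_le b c -> nu_le a c.
Proof.
by move=> /nu_leP ab /nu_leP bc; apply/nu_leP; rewrite -bc addrA ab.
Qed.

Lemma nu_le_anti a b : nu_le a b -> nu_le b a -> nu a = nu b.
Proof. by move=> /nu_leP ab /nu_leP ba; rewrite -ba addrC. Qed.

Lemma nu_le_total a b : nu_le a b || nu_le b a.
Proof.
case: (eqVneq (nu a) (nu b)) => [/nu_eq_le -> //|/eqP ne].
have ne2 : nu (nu a) <> nu (nu b) by rewrite !nu_idem.
case: (addr_bipotent _ _ ne2) => e; apply/orP; [right|left]; apply/nu_leP=> //.
by rewrite addrC.
Qed.

Lemma nu_gtE a b : nu_gt a b = ~~ nu_le a b.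
Proof.
have := nu_le_total a b; rewrite /nu_gt -/(nu_le b a).
case: (boolP (nu_le a b)) => [ab _|nab /= -> /=].
  case: (boolP (nu_le b a)) => //= ba.
  by rewrite (nu_le_anti ab ba) eqxx.
by apply: contraNneq nab => /nu_eq_le.
Qed.

Lemma nu_gt_le a b : nu_gt a b -> nu_le b a.
Proof. by case/andP. Qed.

Lemma nu_le_gt_trans b a c : nu_gt a b -> nu_le c b -> nu_gt a c.
Proof.
rewrite !nu_gtE => + cb; apply: contra => ac; exact: nu_le_trans ac cb.
Qed.

Lemma nu_ge_gt_trans b a c : nu_le b a -> nu_gt b c -> nu_gt a c.
Proof.
rewrite !nu_gtE => ba; apply: contra => ac; exact: nu_le_trans ba ac.
Qed.

Lemma nu_add_absorb a b : nu_le a b -> nu (a + b) = nu b.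
Proof. by move=> /nu_leP ab; rewrite nuD. Qed.

Lemma nu_le_addr a b : nu_le a (a + b).
Proof. by apply/nu_leP; rewrite nuD addrA addrr_nu nu_idem. Qed.

Lemma nu_le_addl a b : nu_le b (a + b).
Proof. by rewrite addrC nu_le_addr. Qed.

Lemma nu_le_mull c a b : nu_le a b -> nu_le (c * a) (c * b).
Proof. by move=> /nu_leP ab; apply/nu_leP; rewrite !nuM -mulrDr ab. Qed.

Lemma nu_le_mul a b c d : nu_le a b -> nu_le c d -> nu_le (a * c) (b * d).
Proof.
move=> ab cd; apply: (@nu_le_trans (a * d)); first exact: nu_le_mull.
by rewrite ![_ * d]mulrC nu_le_mull.
Qed.

Lemma nu_le_pow n a b : nu_le a b -> nu_le (a ^+ n) (b ^+ n).
Proof.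
move=> ab; elim: n => [|n IH]; first exact: nu_le_refl.
by rewrite !exprS nu_le_mul.
Qed.

Lemma nu_mul_nu a b : nu (nu a * b) = nu (a * b).
Proof. by rewrite !nuM nu_idem. Qed.

Lemma nu_mul1 a : nu 1 * nu a = nu a.
Proof. exact/nu1_ghost/nu_ghost. Qed.

(** The sum g + g = (1 + 1) * g is nu g as well as nu 1 * g. *)
Lemma nu_id g : g \in ghost -> nu g = g.
Proof.
move=> gg; rewrite -[RHS]nu1_ghost // -[nu 1]addrr_nu mulrDl mul1r.
by rewrite addrr_nu.
Qed.

Lemma add_dominant a b : nu_gt a b -> a + b = a.
Proof.
case/andP => /eqP ge /eqP ne.
by case: (addr_bipotent _ _ ne) => // e; case: ne; rewrite -ge -nuD e.
Qed.

(** A sum is one of its terms or a ghost, and a tangible term that is at most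
    a ghost one cannot be selected. *)
Lemma ghost_add_absorb a b : b \in ghost -> nu_le a b -> a + b \in ghost.
Proof.
move=> gb ab; case: (eqVneq (nu a) (nu b)) => [e|ne].
  by rewrite addr_nu_eq // nu_ghost.
rewrite addrC add_dominant // nu_gtE; apply: contra ne => ba.
by apply/eqP/nu_le_anti.
Qed.

Lemma ghost_sum I (r : seq I) (P : pred I) (E : I -> R) :
  (forall i, P i -> E i \in ghost) -> \sum_(i <- r | P i) E i \in ghost.
Proof.
move=> gE; elim/big_ind: _ => //; [exact: ghost0 | exact: ghostD].
Qed.

Lemma nu_le_sum n (E : 'I_n -> R) i : nu_le (E i) (\sum_j E j).
Proof. by rewrite (bigD1 i) //= nu_le_addr. Qed.

End NuOrder.

(** * Cancellation in a supertropical semifield *)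

Section Semifield.
Variable F : supertropicalSemifieldType.
Implicit Types a b c : F.

Lemma tangible_prod n (E : 'I_n -> F) :
  (forall i, E i \in tangible) -> \prod_i E i \in tangible.
Proof.
move=> tE; elim/big_ind: _ => //; [exact: tangible1 | exact: tangibleM].
Qed.

Lemma tangible_pow a n : a \in tangible -> a ^+ n \in tangible.
Proof.
move=> ta; elim: n => [|n IH]; first exact: tangible1.
by rewrite exprS tangibleM.
Qed.

Lemma tangible_neq0 a : a \in tangible -> a <> 0.
Proof. by move=> + a0; rewrite a0 inE ghost0. Qed.

Lemma nu_eq0 a : nu a = nu 0 -> a = 0.
Proof.
rewrite nu0 => e; case: (boolP (a \in ghost)) => [/nu_id <- //|ta].
by have := nu_tangible_neq0 _ ta; rewrite e eqxx.
Qed.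

(** A nonzero ghost has the nu-value of some tangible element, which is
    invertible. *)
Lemma nu_inv c : c <> 0 -> exists d : F, nu (d * c) = nu 1.
Proof.
move=> c0; have [c' tc' e] : exists2 c', c' \in tangible & nu c' = nu c.
  case: (boolP (c \in ghost)) => [gc|tc]; last by exists c.
  have [|c' tc' e] := nu_tangible_onto _ gc; first exact/eqP.
  by exists c' => //; rewrite e nu_id.
have [d _ cd] := tangible_inv _ tc'.
by exists d; rewrite nuM -e -nuM mulrC cd.
Qed.

Lemma nu_le_cancel c a b : c <> 0 -> nu_le (c * a) (c * b) -> nu_le a b.
Proof.
move=> /nu_inv [d dc] /(nu_le_mull d).
by rewrite /nu_le !mulrA !(nuM (d * c)) dc !nu_mul1.
Qed.

Lemma nu_cancel c a b : c <> 0 -> nu (c * a) = nu (c * b) -> nu a = nu b.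
Proof.
by move=> c0 e; apply: nu_le_anti; apply: (nu_le_cancel c0); apply: nu_eq_le.
Qed.

Lemma nu_gt_mul c a b : c <> 0 -> nu_gt a b -> nu_gt (c * a) (c * b).
Proof. by rewrite !nu_gtE => c0; apply: contra; apply: nu_le_cancel. Qed.

Lemma nu_gt_pow n a b :
  (0 < n)%N -> b \in tangible -> nu_gt a b -> nu_gt (a ^+ n) (b ^+ n).
Proof.
case: n => // n _ tb ab; rewrite !exprS ![_ * _ ^+ n]mulrC.
apply: (@nu_ge_gt_trans _ (b ^+ n * a)).
  by rewrite nu_le_mul ?nu_le_refl ?nu_le_pow // nu_gt_le.
exact/nu_gt_mul/ab/tangible_neq0/tangible_pow.
Qed.

Lemma nu_gt_neq0 a b : nu_gt a b -> a <> 0.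
Proof.
move=> /andP[/eqP ge /eqP ne] a0; apply: ne.
by rewrite -ge a0 nu0 add0r.
Qed.

Lemma pow_neq0 a n : a <> 0 -> a ^+ n <> 0.
Proof.
move=> a0; elim: n => [|n IH]; first exact/eqP/oner_neq0.
rewrite exprS => am0; apply: IH; apply/nu_eq0/(nu_cancel a0).
by rewrite am0 mulr0.
Qed.

(** * Dominant indices and corner roots *)

Definition dominant_index (b : nat -> F) a i :=
  b i <> 0 /\ forall k, nu_le (b k * a ^+ k) (b i * a ^+ i).

(** If j > i, moving from a to a' multiplies the monomial of index j by a
    larger factor than the one of index i, so i cannot become dominant. *)
Lemma dominant_index_mono (b : nat -> F) a a' i j :
  a \in tangible -> a' \in tangible -> nu_gt a' a ->
  dominant_index b a j -> dominant_index b a' i -> (j <= i)%N.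
Proof.
move=> ta ta' aa' [bj0 maxj] [_ maxi]; rewrite leqNgt; apply/negP => ij.
have d0 : (0 < j - i)%N by rewrite subn_gt0.
have := nu_gt_mul bj0 (nu_gt_pow d0 ta aa'); rewrite nu_gtE => /negP; apply.
apply: (@nu_le_trans _ (b i)).
  apply: (@nu_le_cancel (a' ^+ i)); first exact/tangible_neq0/tangible_pow.
  by rewrite mulrCA -exprD subnKC 1?ltnW // [_ * b i]mulrC.
apply: (@nu_le_cancel (a ^+ i)); first exact/tangible_neq0/tangible_pow.
by rewrite mulrCA -exprD subnKC 1?ltnW // [_ * b i]mulrC.
Qed.

Lemma corner_root_dominant (f : {poly F}) a : corner_root f a ->
  exists i j, [/\ (i < j)%N, dominant_index (nth 0 (essential_part f)) a i
                & dominant_index (nth 0 (essential_part f)) a j].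
Proof.
case=> i [j [/eqP ne bi bj e maxi]].
have di : dominant_index (nth 0 (essential_part f)) a i by split.
have dj : dominant_index (nth 0 (essential_part f)) a j.
  by split=> // k; rewrite /nu_le -e; apply: maxi.
by case: (ltngtP i j) ne => // ij _; [exists i, j | exists j, i].
Qed.

Lemma essential_part_coef (f : {poly F}) i : (essential_part f)`_i <> 0 ->
  (i < size f)%N /\ (essential_part f)`_i = f`_i.
Proof. by rewrite coef_poly; case: ifP => // _; case: ifP. Qed.

End Semifield.

(** Passing through each of the t sets D 0, ..., D (t - 1) climbs by at least
    one, and t is all the room that [0, t] leaves.  Hence the indices of D k are
    at least k, counting from the left, and at most k + 1, counting from the
    right. *)
Lemma consecutive_pairs (t : nat) (D : nat -> nat -> Prop) :
  (forall k j, (k < t)%N -> D k j -> (j <= t)%N) ->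
  (forall k, (k < t)%N -> exists i j, [/\ (i < j)%N, D k i & D k j]) ->
  (forall k j i, (k.+1 < t)%N -> D k j -> D k.+1 i -> (j <= i)%N) ->
  forall k, (k < t)%N -> D k k /\ D k k.+1.
Proof.
move=> ub two mono.
have lo k : (k < t)%N -> forall i, D k i -> (k <= i)%N.
  elim: k => // k IH kt i Di; have [i0 [j0 [ij Di0 Dj0]]] := two k (ltnW kt).
  by have := IH (ltnW kt) _ Di0; have := mono _ _ _ kt Dj0 Di; lia.
have hi m : forall k j, (k + m.+1)%N = t -> D k j -> (j <= k.+1)%N.
  elim: m => [|m IH] k j kt Dj.
    by have := ub k j; rewrite -kt addn1 ltnSn => /(_ isT Dj).
  have k1t : (k.+1 < t)%N by lia.
  have [i0 [j0 [ij Di0 Dj0]]] := two _ k1t.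
  have := mono _ _ _ k1t Dj Di0.
  by have := IH k.+1 j0 _ Dj0; lia.
move=> k kt; have [i [j [ij Di Dj]]] := two _ kt.
have li := lo _ kt _ Di.
have hj : (j <= k.+1)%N by apply: (hi (t - k.+1)%N) => //; lia.
have [ei ej] : i = k /\ j = k.+1 by lia.
by rewrite {}ei {}ej in Di Dj.
Qed.

Section CornerRoots.
Variable F : supertropicalSemifieldType.
Implicit Types (f : {poly F}) (a : F) (b r : nat -> F).

(** This is where the number of corner roots enters: the dominant indices at
    the k-th corner root are forced to be k and k + 1.  The roots are counted
    from 0, and the coefficients of the essential part at dominant indices are
    nonzero, hence those of f. *)
Lemma corner_root_tie f (t : nat) r :
  size f = t.+1 -> (forall k, (k < t)%N -> r k \in tangible) ->
  (forall k, (k < t)%N -> corner_root f (r k)) ->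
  (forall k, (k.+1 < t)%N -> nu_gt (r k.+1) (r k)) ->
  forall k, (k < t)%N -> nu f`_k = nu (f`_k.+1 * r k).
Proof.
move=> sf tr cr inc k kt.
set b := nth 0 (essential_part f).
have dom : forall k, (k < t)%N ->
    dominant_index b (r k) k /\ dominant_index b (r k) k.+1.
  apply: (@consecutive_pairs t (fun k => dominant_index b (r k))).
  - by move=> l j _ [/essential_part_coef[+ _] _]; rewrite sf ltnS.
  - by move=> l lt; apply/corner_root_dominant/cr.
  - move=> l j i lt; apply: dominant_index_mono; last exact: inc.
      by apply: tr; apply: ltnW.
    exact: tr.
have [[bk0 maxk] [bk1 maxk1]] := dom k kt.
apply: (@nu_cancel _ (r k ^+ k)).
  exact/tangible_neq0/tangible_pow/tr.
rewrite -(proj2 (essential_part_coef bk0)) -(proj2 (essential_part_coef bk1)).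
rewrite mulrC mulrCA -exprSr.
exact: nu_le_anti.
Qed.

(** * Nu-values in terms of the corner roots *)

Lemma nu_prod_eq n (E E' : 'I_n -> F) :
  (forall i, nu (E i) = nu (E' i)) -> nu (\prod_i E i) = nu (\prod_i E' i).
Proof.
move=> e; elim/big_ind2: _ => // x x' y y' ex ey.
by rewrite !nuM ex ey.
Qed.

Lemma nu_prod_ge a n r : nu_le (a ^+ n) (\prod_(k < n) (a + r k)).
Proof.
elim: n => [|n IH]; first by rewrite big_ord0 nu_le_refl.
by rewrite big_ord_recr exprSr nu_le_mul // nu_le_addr.
Qed.

Lemma nu_coef_prod n b r :
  (forall k, (k < n)%N -> nu (b k) = nu (b k.+1 * r k)) ->
  nu (b 0%N) = nu (b n * \prod_(k < n) r k).
Proof.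
elim: n => [|n IH] eb; first by rewrite big_ord0 mulr1.
rewrite big_ord_recr IH => [|k kn]; last exact/eb/ltnW.
by rewrite nuM eb // -nuM -mulrA [r n * _]mulrC.
Qed.

(** The max-plus factorization, by induction on n: the last factor a + r n is
    either a, in which case a dominates all roots and the product so far is
    a ^ n, or r n, in which case the new monomial is dominated. *)
Lemma nu_sum_prod a n b r :
  (forall k, (k < n)%N -> nu (b k) = nu (b k.+1 * r k)) ->
  (forall j k, (j < k)%N -> (k < n)%N -> nu_le (r j) (r k)) ->
  nu (\sum_(k < n.+1) b k * a ^+ k) = nu (b n * \prod_(k < n) (a + r k)).
Proof.
elim: n => [|n IH] eb inc.
  by rewrite big_ord_recr big_ord0 big_ord0 /= add0r expr0.
rewrite big_ord_recr [in RHS]big_ord_recr /= nuD IH; first last.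
- by move=> j k jk kn; apply: inc => //; apply: ltnW.
- by move=> k kn; apply: eb; apply: ltnW.
set P := \prod_(k < n) _.
rewrite nuM eb // -nuM -nuD -mulrA -mulrDr (nuM (b n.+1)) (nuM (b n.+1)).
congr (_ * _).
have [ar|ra] := orP (nu_le_total a (r n)).
- rewrite addrC nu_add_absorb; last first.
    by rewrite exprSr mulrC nu_le_mul // nu_prod_ge.
  by rewrite !nuM nu_add_absorb // mulrC.
- have eP : nu P = nu (a ^+ n).
    have -> : a ^+ n = \prod_(k < n) a by rewrite prodr_const card_ord.
    apply: nu_prod_eq => i; rewrite addrC nu_add_absorb //.
    by apply: nu_le_trans ra; apply: inc.
  by rewrite exprSr nuD !nuM eP nuD mulrDr addrC [nu (r n) * _]mulrC.
Qed.

(** * Parity of the values *)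

(** The sum of the other monomials has the nu-value of
    r (n - 1) * a ^ (n - 1), by the max-plus factorization with one root less;
    the equality holds in F itself because that is smaller than a ^ n. *)
Lemma sum_dominant_last a n b r :
  b n = 1 -> (forall k, (k < n)%N -> nu (b k) = nu (b k.+1 * r k)) ->
  (forall j k, (j < k)%N -> (k < n)%N -> nu_le (r j) (r k)) ->
  (forall k, (k < n)%N -> nu_gt a (r k)) ->
  \sum_(k < n.+1) b k * a ^+ k = a ^+ n.
Proof.
case: n => [|n] bn eb inc gt.
  by rewrite big_ord_recr big_ord0 /= add0r bn mul1r.
rewrite big_ord_recr /= bn mul1r addrC; apply: add_dominant.
apply: (@nu_le_gt_trans _ (a ^+ n * r n)).
  rewrite exprSr; apply: nu_gt_mul; last exact: gt.
  exact/pow_neq0/(nu_gt_neq0 (gt n (ltnSn n))).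
apply: nu_eq_le; rewrite (@nu_sum_prod _ _ _ r); first last.
- by move=> j k jk kn; apply: inc => //; apply: ltnW.
- by move=> k kn; apply: eb; apply: ltnW.
rewrite nuM eb // bn mul1r mulrC nuM; congr (_ * _).
have -> : a ^+ n = \prod_(k < n) a by rewrite prodr_const card_ord.
congr nu; apply: eq_bigr => i _; apply: add_dominant; apply: gt.
by apply: ltnW; rewrite ltnS.
Qed.

(** The other monomials are a times a sum to which the max-plus factorization
    with roots r 1, ..., r (n - 1) applies; compare it with r 0 times the same
    product.  No power of a is cancelled, so a may be 0. *)
Lemma sum_dominant_first a n b r :
  b n = 1 -> (forall k, (k < n)%N -> nu (b k) = nu (b k.+1 * r k)) ->
  (forall j k, (j < k)%N -> (k < n)%N -> nu_le (r j) (r k)) ->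
  (forall k, (k < n)%N -> r k \in tangible) ->
  (forall k, (k < n)%N -> nu_gt (r k) a) ->
  \sum_(k < n.+1) b k * a ^+ k = b 0%N.
Proof.
case: n => [|n] bn eb inc tr gt.
  by rewrite big_ord_recr big_ord0 /= add0r mulr1.
rewrite big_ord_recl /= mulr1; apply: add_dominant.
under eq_bigr => k _ do rewrite exprS mulrCA.
rewrite -mulr_sumr.
have eS : nu (\sum_(k < n.+1) b k.+1 * a ^+ k)
    = nu (\prod_(k < n) r k.+1).
  rewrite (@nu_sum_prod _ n (fun k => b k.+1) (fun k => r k.+1)).
  - rewrite bn mul1r; congr nu; apply: eq_bigr => i _.
    by rewrite addrC add_dominant // gt // ltnS.
  - by move=> k kn; apply: eb.
  - by move=> j k jk kn; apply: inc.
set S := \sum_(_ < _) _ in eS *.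
have e0 : nu (b 0%N) = nu (\prod_(k < n) r k.+1 * r 0%N).
  by rewrite (nu_coef_prod eb) bn mul1r big_ord_recl mulrC.
have P0 : \prod_(k < n) r k.+1 <> 0.
  by apply/tangible_neq0/tangible_prod => i; apply: tr; rewrite ltnS.
have := nu_gt_mul P0 (gt 0%N isT).
by rewrite /nu_gt -e0 (nuM _ a) -eS -nuM [S * a]mulrC.
Qed.

(** The inner monomials are ghosts; those of index 1 and n + 1 absorb the
    extreme ones. *)
Lemma sum_ghost_middle a n b r :
  (forall k, (k < n.+2)%N -> nu (b k) = nu (b k.+1 * r k)) ->
  (forall k, (0 < k < n.+2)%N -> b k \in ghost) ->
  nu_le (r 0%N) a -> nu_le a (r n.+1) ->
  \sum_(k < n.+3) b k * a ^+ k \in ghost.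
Proof.
move=> eb gb ra ar; rewrite big_ord_recl big_ord_recr /=.
set M := \sum_(i < n.+1) _.
have gM : M \in ghost.
  apply: ghost_sum => i _; rewrite mulrC ghostMl //.
  by apply: gb; move: (ltn_ord i); rewrite /bump /=; lia.
have M1 : nu_le (b 0%N) M.
  apply: nu_le_trans (nu_eq_le (eb 0%N isT)) _.
  apply: nu_le_trans (nu_le_mull _ ra) _.
  exact: (nu_le_sum (fun i : 'I_n.+1 => b (bump 0 i) * a ^+ bump 0 i) ord0).
have M2 : nu_le (b n.+2 * a ^+ n.+2) M.
  apply: (@nu_le_trans _ (b n.+1 * a ^+ n.+1)); last first.
    exact: (nu_le_sum
              (fun i : 'I_n.+1 => b (bump 0 i) * a ^+ bump 0 i) ord_max).
  rewrite exprS mulrA; apply: nu_le_mul (nu_le_refl _).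
  apply: nu_le_trans (nu_le_mull _ ar) _.
  exact/nu_eq_le/esym/eb.
rewrite mulr1 [M + _]addrC; apply: ghost_add_absorb.
  exact: ghost_add_absorb.
by apply: nu_le_trans M1 _; apply: nu_le_addl.
Qed.

End CornerRoots.

Theorem proposition8p46 (F : supertropicalSemifieldType)
    (F_divisibly_closed : divisibly_closed F)
    (t : nat) (t_ge2 : (2 <= t)%N)
    (f : {poly F})
    (f_degree : size f = t.+1)
    (f_monic : f \is monic)
    (f_semitangibly_full : semitangibly_full f)
    (alpha : nat -> F)
    (alpha_tangible : forall k : nat, (1 <= k <= t)%N -> alpha k \in tangible)
    (alpha_corner : forall k : nat, (1 <= k <= t)%N -> corner_root f (alpha k))
    (alpha_ascending : forall j k : nat,
       (1 <= j)%N -> (j < k)%N -> (k <= t)%N -> nu_gt (alpha k) (alpha j)) :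
  let g : {poly F} :=
    ('X^2 + (nu (alpha t))%:P * 'X + (alpha t * alpha 1%N)%:P)
      * \prod_(2 <= k < t) ('X + (alpha k)%:P) in
  nu_e_equiv f g /\ ({in tangible &, injective (@nu F)} -> e_equiv f g).
Proof.
case: t t_ge2 f_degree alpha_tangible alpha_corner alpha_ascending
  => [//|[//|n]] _ sf ta ca inc g.
have [_ _ tf0 gf] := f_semitangibly_full; rewrite sf /= in gf.
have f1 : f`_n.+2 = 1 by have /monicP := f_monic; rewrite lead_coefE sf.
(* Count the roots from 0, as the indices of the ordinals. *)
pose r k := alpha k.+1.
have tr k : (k < n.+2)%N -> r k \in tangible by move=> kn; apply: ta.
have incr j k : (j < k)%N -> (k < n.+2)%N -> nu_gt (r k) (r j).
  by move=> jk kn; apply: inc.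
have incr_le j k : (j < k)%N -> (k < n.+2)%N -> nu_le (r j) (r k).
  by move=> jk kn; apply/nu_gt_le/incr.
have tie : forall k, (k < n.+2)%N -> nu f`_k = nu (f`_k.+1 * r k).
  by apply: corner_root_tie => // [k kn|k kn]; [apply: ca | apply: incr].
have fa a : f.[a] = \sum_(k < n.+3) f`_k * a ^+ k by rewrite horner_coef sf.
pose Q a := \prod_(k < n) (a + r k.+1).
have ga a : g.[a] = (a ^+ 2 + nu (r n.+1) * a + r n.+1 * r 0%N) * Q a.
  rewrite /g hornerM !hornerE horner_prod; congr (_ * _).
  rewrite !big_add1 /= big_mkord; apply: eq_bigr => i _.
  by rewrite !hornerE.
have nufg a : nu f.[a] = nu g.[a].
  rewrite fa (nu_sum_prod _ tie incr_le) f1 mul1r ga.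
  rewrite big_ord_recl big_ord_recr /= -[\prod_(i < n) _]/(Q a).
  (* The factors of the smallest and the largest root make up the quadratic
     one, since nu (r 0 + r (n + 1)) = nu (r (n + 1)). *)
  have -> : (a + r 0%N) * (Q a * (a + r n.+1))
      = (a ^+ 2 + (r 0%N + r n.+1) * a + r n.+1 * r 0%N) * Q a by ring.
  rewrite !(nuM _ (Q a)) !(nuD _ (r n.+1 * _)) !(nuD (a ^+ 2)).
  by rewrite nu_mul_nu !(nuM _ a) nu_add_absorb // incr_le.
have ghfg a : (f.[a] \in ghost) = (g.[a] \in ghost).
  case: (boolP (nu_le a (r n.+1))) => [ar|]; last first.
    rewrite -nu_gtE => gt.
    have gtr k : (k < n.+2)%N -> nu_gt a (r k).
      rewrite ltnS leq_eqVlt => /predU1P[-> //|kn].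
      by apply: nu_le_gt_trans gt _; apply: incr_le.
    rewrite fa (sum_dominant_last f1 tie incr_le gtr) ga.
    have -> : Q a = a ^+ n.
      rewrite -[n in RHS]card_ord -prodr_const; apply: eq_bigr => i _.
      by apply: add_dominant; apply: gtr; rewrite !ltnS ltnW.
    have a0 := nu_gt_neq0 gt.
    have aa c : nu_gt a c -> nu_gt (a ^+ 2) (c * a).
      by rewrite [c * a]mulrC; apply: nu_gt_mul.
    rewrite (add_dominant (aa _ _)); last by rewrite /nu_gt nu_idem.
    rewrite add_dominant -?exprD //.
    apply: (nu_le_gt_trans (aa _ gt)).
    by apply/nu_le_mull/nu_gt_le/gtr.
  case: (boolP (nu_le (r 0%N) a)) => [ra|]; last first.
    rewrite -nu_gtE => lt.
    have ltr k : (k < n.+2)%N -> nu_gt (r k) a.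
      case: k => // k kn.
      by apply: nu_ge_gt_trans lt; apply: incr_le.
    rewrite fa (sum_dominant_first f1 tie incr_le tr ltr).
    suff tg : g.[a] \in tangible.
      by rewrite (negbTE tg) (negbTE (tf0 : _ \notin _)).
    rewrite ga; apply: tangibleM; last first.
      apply: tangible_prod => i; rewrite addrC add_dominant.
        by apply: tr; rewrite !ltnS ltnW.
      by apply: ltr; rewrite !ltnS ltnW.
    have gtl : nu_gt (r n.+1 * r 0%N) (r n.+1 * a).
      by apply: nu_gt_mul lt; apply/tangible_neq0/tr.
    rewrite addrC add_dominant; first by apply: tangibleM; apply: tr.
    apply: (nu_le_gt_trans gtl); apply/nu_eq_le.
    rewrite nuD nu_mul_nu -nuD nu_add_absorb //.
    by apply: nu_le_mul; rewrite ?nu_le_refl // nu_gt_le // ltr.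
  rewrite fa (sum_ghost_middle tie gf ra ar); symmetry.
  rewrite ga mulrC ghostMl //.
  have gm : nu (r n.+1) * a \in ghost by rewrite mulrC ghostMl // nu_ghost.
  have gm_eq := nu_eq_le (esym (nu_mul_nu (r n.+1) a)).
  rewrite addrC; apply: ghost_add_absorb.
    apply: ghost_add_absorb => //; apply: nu_le_trans gm_eq.
    by rewrite nu_le_mul // nu_le_refl.
  apply: nu_le_trans (nu_le_addl _ _); apply: nu_le_trans gm_eq.
  exact: nu_le_mull.
split=> [a|inj a]; first by split.
(* Ghosts are their own nu-values; tangible values need the injectivity. *)
have := nufg a; have := ghfg a.
case: (boolP (f.[a] \in ghost)) => [gfa /esym gga|tfa /esym/negbT tga].
  by rewrite !nu_id.
exact: inj.
Qed.
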